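(* For every integer $N\ge 0$, the map $H\mapsto\mathrm{Chain}(H)$ is a bijection from the set of Okada half arc-diagrams of rank $N$ to the set of saturated chains $\emptyset_0=C_0\lhd C_1\lhd\dots\lhd C_N$ of rank $N$ (i.e. starting at the rank $0$ element and ending at an element of rank $N$) in the lattice $\mathbb{YFS}$ of Fibonacci sets.
   Context: Write $[N]=\{1,\dots,N\}$. A Fibonacci set of rank $n$ is a subset $S=\{s_1<\dots<s_k\}\subseteq[n]$ with $k\equiv n\pmod 2$ and $s_\ell\equiv\ell\pmod2$ for all $\ell$. The rank is part of the data (the same subset with different ranks gives different Fibonacci sets); $\mathbb{YFS}$ is the disjoint union over $n$ of the sets $\mathbb{YFS}_n$ of Fibonacci sets of rank $n$. It is a lattice (the Young–Fibonacci lattice) generated by the covering relations $S\lhd T$, which hold iff $S\in\mathbb{YFS}_{n-1}$, $T\in\mathbb{YFS}_n$ for some $n$, and one of the two sets can be obtained from the other by removing its largest element. An Okada half arc-diagram $H$ of rank $N$ is what is obtained by cutting an Okada arc-diagram in the middle: a set of pairwise disjoint pairs in $[N]$ (full arcs $\{a,b\}$, $a<b$), each remaining element $a\in[N]$ carrying a (propagating) half arc, such that: no two full arcs cross; no half arc node $c$ satisfies $a<c<b$ for a full arc $\{a,b\}$; each full arc $\{a,b\}$ ($a<b$) and each half arc at $a$ carries an integer height label $h$ with $1\le h\le a$ and $h\equiv a\pmod2$; the label of a full arc $\{a,b\}$ is strictly larger than that of a full arc $\{c,d\}$ whenever $c<a<b<d$; and any full arc or half arc all of whose nodes are greater than $c$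 has label strictly larger than that of the half arc at $c$ (if there is a half arc at $c$). The propagating label set $\mathrm{PLab}(H)$ is the set of labels of the half arcs of $H$; it is a Fibonacci set of rank $N$. For $r\le N$, the $r$-restriction $H/[r]$ is the Okada half arc-diagram of rank $r$ having: a full arc $\{a,b\}$ with label $h$ whenever $H$ has the full arc $\{a,b\}$ with label $h$ and $a,b\le r$; a half arc at $a$ with label $h$ whenever $H$ has either a full arc $\{a,b\}$ with label $h$ and $a\le r<b$, or a half arc at $a\le r$ with label $h$. Finally $\mathrm{Chain}(H)=(C_0,\dots,C_N)$, where $C_i=\mathrm{PLab}(H/[i])\in\mathbb{YFS}_i$. *)

(* Defs.v *)
From mathcomp Require Import all_boot finmap.

Set Implicit Arguments.
Unset Strict Implicit.
Unset Printing Implicit Defensive.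

Local Open Scope nat_scope.
Local Open Scope fset_scope.

(** A finite set of integers together with a rank: the same set with two
    different ranks gives two different objects. *)
Record ranked_set := RankedSet { rank : nat; elts : {fset nat} }.

(** With [s_1 < ... < s_k] the elements in increasing order, [s_l.+1] is
    [nth 0 (sort leq S) l]. *)
Definition fibonacci_set (S : ranked_set) : Prop :=
  [/\ forall s, s \in elts S -> 1 <= s <= rank S,
      #|` elts S | = rank S %[mod 2] &
      forall l, l < #|` elts S | ->
        nth 0 (sort leq (elts S)) l = l.+1 %[mod 2] ].

(** [B] is [A] minus its largest element; in particular [A] is nonempty. *)
Definition remove_max (A B : {fset nat}) : Prop :=
  exists m, [/\ m \in A, forall x, x \in A -> x <= m & B = A `\ m].

Definition covered_by (S T : ranked_set) : Prop :=
  [/\ fibonacci_set S, fibonacci_set T, rank T = (rank S).+1 &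
      remove_max (elts S) (elts T) \/ remove_max (elts T) (elts S)].

Definition saturated_chain (N : nat) (C : {ffun 'I_N.+1 -> ranked_set}) : Prop :=
  C ord0 = RankedSet 0 fset0 /\
  forall i, i < N -> covered_by (C (inord i)) (C (inord i.+1)).

(** [(a, b, h) \in full H] is a full arc [{a, b}], [a < b], with label [h];
    [(a, h) \in half H] is a half arc at [a] with label [h]. *)
Record half_diagram := HalfDiagram {
  full : {fset nat * nat * nat};
  half : {fset nat * nat} }.

Definition full_node (H : half_diagram) (c : nat) : Prop :=
  exists a b h, (a, b, h) \in full H /\ (c = a \/ c = b).

(** Labels are stored inside the arcs, so [full_disjoint] and [half_label_uniq]
    also say that each arc has only one label. *)
Record okada_half_diagram (N : nat) (H : half_diagram) : Prop :=
  OkadaHalfDiagram {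
  full_bounds : forall a b h, (a, b, h) \in full H ->
    [/\ 1 <= a, a < b & b <= N];
  full_disjoint : forall a b h c d k,
    (a, b, h) \in full H -> (c, d, k) \in full H ->
    [\/ a = c, a = d, b = c | b = d] -> (a, b, h) = (c, d, k);
  half_bounds : forall a h, (a, h) \in half H -> 1 <= a <= N;
  half_nodes : forall a, 1 <= a <= N ->
    (exists h, (a, h) \in half H) <-> ~ full_node H a;
  half_label_uniq : forall a h k,
    (a, h) \in half H -> (a, k) \in half H -> h = k;
  full_noncrossing : forall a b h c d k,
    (a, b, h) \in full H -> (c, d, k) \in full H -> ~ (a < c < b /\ b < d);
  half_exposed : forall a b h c k,
    (a, b, h) \in full H -> (c, k) \in half H -> ~ (a < c < b);
  full_label : forall a b h, (a, b, h) \in full H ->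
    1 <= h <= a /\ h = a %[mod 2];
  half_label : forall a h, (a, h) \in half H ->
    1 <= h <= a /\ h = a %[mod 2];
  label_nested : forall a b h c d k,
    (a, b, h) \in full H -> (c, d, k) \in full H ->
    c < a -> b < d -> k < h;
  label_half_full : forall c k a b h,
    (c, k) \in half H -> (a, b, h) \in full H -> c < a -> k < h;
  label_half_half : forall c k a h,
    (c, k) \in half H -> (a, h) \in half H -> c < a -> k < h }.

Definition restriction (r : nat) (H : half_diagram) : half_diagram :=
  HalfDiagram
    [fset x in full H | x.1.2 <= r]
    ([fset x in half H | x.1 <= r] `|`
     [fset (x.1.1, x.2) | x in full H & x.1.1 <= r < x.1.2]).

Definition PLab (H : half_diagram) : {fset nat} := [fset x.2 | x in half H].

Definition Chain (N : nat) (H : half_diagram) : {ffun 'I_N.+1 -> ranked_set} :=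
  [ffun i : 'I_N.+1 => RankedSet i (PLab (restriction i H))].

(* Main.v *)
(** Reading a diagram from left to right, its half arcs (the arcs still open)
    form a stack whose labels increase from bottom to top: going from [H/[i]]
    to [H/[i+1]], the node [i+1] either pushes a half arc with a new largest
    label or closes the half arc with the largest label. Conversely, a diagram
    of rank [i] together with the next propagating label set determines which of
    the two happens: a pushed label is the new maximum, and its parity is forced
    by the Fibonacci condition; a closed arc is the one carrying the removed
    label. *)
Require Import Defs.
From mathcomp Require Import all_boot finmap.
From mathcomp Require Import classical_sets functions.
From mathcomp Require Import zify.

(* ssrnat also has a [half], which must not hide the projection of [half_diagram]. *)
Import Defs.

Set Implicit Arguments.
Unset Strict Implicit.
Unset Printing Implicit Defensive.

Local Open Scope nat_scope.
Local Open Scope fset_scope.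

(** * Restriction of half arc-diagrams *)

Lemma in_full_restriction r H a b h :
  ((a, b, h) \in full (restriction r H)) = ((a, b, h) \in full H) && (b <= r).
Proof. by rewrite !inE. Qed.

Lemma in_half_restrictionP r H a h :
  (a, h) \in half (restriction r H) <->
  ((a, h) \in half H /\ a <= r) \/ (exists b, (a, b, h) \in full H /\ a <= r < b).
Proof.
rewrite in_fsetU !inE /=; split.
  case/orP=> [/andP[? ?]|/imfsetP[[[a' b] h'] /=]]; first by left.
  by rewrite inE /= => /andP[? ?] [-> ->]; right; exists b.
case=> [[-> ->]|[b [ab rb]]] //; apply/orP; right.
by apply/imfsetP; exists (a, b, h); rewrite ?inE //= ab.
Qed.

Lemma PLabP H k : k \in PLab H <-> exists a, (a, k) \in half H.
Proof.
split; first by case/imfsetP=> [[a k'] /= ? ->]; exists a.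
by case=> a ak; apply/imfsetP; exists (a, k).
Qed.

(** The arcs form a finite set, so a boolean search decides. For a node in range, [half_nodes] turns
    the negative case into a half arc. *)
Lemma full_node_dec H c : full_node H c \/ ~ full_node H c.
Proof.
case: (boolP (has (fun x : nat * nat * nat => (c == x.1.1) || (c == x.1.2))
  (enum_fset (full H)))) => [/hasP[[[a b] h] /= ? /orP e]|/hasPn no].
  by left; exists a, b, h; split=> //; case: e => /eqP; [left|right].
right=> -[a [b [h [/no /= /norP[/eqP ? /eqP ?] ]]]]; by case.
Qed.

(** A half arc of the restriction is either a half arc of [H] or a cut full arc. Each condition on
    it thus follows from the half arc or the full arc version of that condition in [H]; for instance
    exposure of a cut arc is noncrossing. *)
Lemma okada_restriction r N H : r <= N ->
  okada_half_diagram N H -> okada_half_diagram r (restriction r H).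
Proof.
move=> rN [fb fd hb hn hu nc he fl hl ln lhf lhh]; split.
- by move=> a b h; rewrite in_full_restriction => /andP[/fb[]].
- by move=> a b h c d k; rewrite !in_full_restriction => /andP[ab _] /andP[cd _]; exact: fd ab cd.
- by move=> a h /in_half_restrictionP[[/hb]|[b [/fb[]]]]; lia.
- move=> a ar; split.
    case=> h /in_half_restrictionP[[ah _]|[b [ab /andP[_ rb]]]] [c [d [k []]]];
    rewrite in_full_restriction => /andP[cd dr] acd.
      have /hn[/(_ (ex_intro _ h ah)) []] : 1 <= a <= N by lia.
      by exists c, d, k.
    have [_ ? _] := fb _ _ _ ab; have [_ ? _] := fb _ _ _ cd.
    have : (a, b, h) = (c, d, k) by apply: fd => //; case: acd => ->; [apply: Or41|apply: Or42].
    by case=> *; lia.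
  (* A node on no full arc of the restriction either carries a half arc of [H] or is the left end of
     an arc whose right end exceeds [r]. *)
  move=> nf; have /hn[_ ha] : 1 <= a <= N by lia.
  have [[b [c [h [bc abc]]]]|/ha[h ah]] := full_node_dec H a; last first.
    by exists h; apply/in_half_restrictionP; left; split=> //; lia.
  have [? ? ?] := fb _ _ _ bc.
  have cr : r < c.
    rewrite ltnNge; apply/negP => cr; apply: nf; exists b, c, h; split=> //.
    by rewrite in_full_restriction bc.
  have ab : a = b by case: abc => // ?; lia.
  by exists h; apply/in_half_restrictionP; right; exists c; rewrite ab; split=> //; lia.
- move=> a h k /in_half_restrictionP[[ah _]|[b [ab ?]]] /in_half_restrictionP[[ak _]|[c [ac ?]]].
  + exact: hu ah ak.
  + have /hn[/(_ (ex_intro _ h ah)) []] : 1 <= a <= N by have := hb _ _ ah; lia.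
    by exists a, c, k; split=> //; left.
  + have /hn[/(_ (ex_intro _ k ak)) []] : 1 <= a <= N by have := hb _ _ ak; lia.
    by exists a, b, h; split=> //; left.
  + have : (a, b, h) = (a, c, k) by apply: fd => //; apply: Or41.
    by case.
- by move=> a b h c d k; rewrite !in_full_restriction => /andP[ab _] /andP[cd _]; exact: nc ab cd.
- move=> a b h c k; rewrite in_full_restriction => /andP[ab br].
  case/in_half_restrictionP=> [[/(he _ _ _ _ _ ab)]|[d [/(nc _ _ _ _ _ _ ab)]]]; lia.
- by move=> a b h; rewrite in_full_restriction => /andP[/fl].
- by move=> a h /in_half_restrictionP[[/hl]|[b [/fl]]].
- by move=> a b h c d k; rewrite !in_full_restriction => /andP[ab _] /andP[cd _]; exact: ln ab cd.
- move=> c k a b h /in_half_restrictionP[[ck _]|[d [cd ?]]];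
  rewrite in_full_restriction => /andP[ab br]; first exact: lhf ck ab.
  by move=> ca; apply: ln ab cd ca _; lia.
- move=> c k a h /in_half_restrictionP[[ck ?]|[d [cd ?]]] /in_half_restrictionP[[ah ?]|[b [ab ?]]] ca.
  + exact: lhh ck ah ca.
  + exact: lhf ck ab ca.
  + by have := he _ _ _ _ _ cd ah; lia.
  (* Both arcs are cut at [r]. Noncrossing excludes [d < b] and disjointness excludes [b = d], so
     the arc at [a] is nested in the arc at [c]. *)
  + have nac : ~ (c < a < d /\ d < b) := nc _ _ _ _ _ _ cd ab.
    have bd : b <> d.
      move=> bd; have : (c, d, k) = (a, b, h) by apply: fd => //; apply: Or44.
      by case; lia.
    by apply: (ln _ _ _ _ _ _ ab cd ca); lia.
Qed.

Lemma restriction_restriction r s H : r <= s ->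
  restriction r (restriction s H) = restriction r H.
Proof.
move=> rs; congr HalfDiagram.
  by apply/fsetP=> -[[a b] h]; rewrite !inE /= -andbA; congr andb; lia.
apply/fsetP=> -[a h]; apply/idP/idP.
  move/in_half_restrictionP=> e; apply/in_half_restrictionP; move: e.
  case=> [[/in_half_restrictionP[[ah ?]|[b [ab ?]]] ?]|[b []]].
  - by left.
  - by right; exists b; split=> //; lia.
  - by rewrite in_full_restriction => /andP[ab ?] ?; right; exists b.
move/in_half_restrictionP=> e; apply/in_half_restrictionP; case: e.
  by case=> ah ar; left; split=> //; apply/in_half_restrictionP; left; split=> //; lia.
(* An arc cut at [r] is either still whole in the [s]-restriction or already a half arc there. *)
case=> b [ab arb]; have [bs|sb] := leqP b s.
  by right; exists b; rewrite in_full_restriction ab.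
left; split; last by lia.
by apply/in_half_restrictionP; right; exists b; split=> //; lia.
Qed.

Lemma restriction_id N H : okada_half_diagram N H -> restriction N H = H.
Proof.
case: H => F G /= oH; congr HalfDiagram; apply/fsetP.
  move=> [[a b] h]; rewrite !inE /=; apply: andb_idr => /(full_bounds oH).
  by case.
move=> [a h]; apply/idP/idP; last first.
  move=> ah; apply/in_half_restrictionP; left; split=> //.
  by have := half_bounds oH ah; lia.
by case/in_half_restrictionP=> [[]|[b [/(full_bounds oH)[]]]] //; lia.
Qed.

(** * Extending a diagram by one node *)

Definition add_half (a h : nat) (H : half_diagram) : half_diagram :=
  HalfDiagram (full H) ((a, h) |` half H).

Definition close_half (c k b : nat) (H : half_diagram) : half_diagram :=
  HalfDiagram ((c, b, k) |` full H) (half H `\ (c, k)).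

(** Push and pop of the stack as a relation. Maximality is stated on [PLab H0], ready for comparison
    with the covering relation. *)
Definition extends (N : nat) (H0 H : half_diagram) : Prop :=
  (exists h, [/\ 1 <= h <= N.+1, h = N.+1 %[mod 2],
      forall k, k \in PLab H0 -> k < h & H = add_half N.+1 h H0]) \/
  (exists c k, [/\ (c, k) \in half H0, forall l, l \in PLab H0 -> l <= k &
      H = close_half c k N.+1 H0]).

(** Labels of half arcs increase strictly with position. Hence a label names its half arc, and
    closing that arc removes the label from [PLab]. *)
Lemma half_label_inj N H a b h : okada_half_diagram N H ->
  (a, h) \in half H -> (b, h) \in half H -> a = b.
Proof.
move=> oH ah bh; have [ab|ab|//] := ltngtP a b.
  by have := label_half_half oH ah bh ab; lia.
by have := label_half_half oH bh ah ab; lia.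
Qed.

Lemma okada_half_not_full N H a h : okada_half_diagram N H ->
  (a, h) \in half H -> ~ full_node H a.
Proof.
by move=> oH ah; apply/(half_nodes oH (half_bounds oH ah)); exists h.
Qed.

Lemma restriction_extends N H : okada_half_diagram N.+1 H ->
  extends N (restriction N H) H.
Proof.
move=> oH; have oR := okada_restriction (leqnSn N) oH.
have hn : 1 <= N.+1 <= N.+1 by lia.
have [[a [c [k [ac e]]]]|/(half_nodes oH hn)[h nh]] := full_node_dec H N.+1.
  right; exists a, k; have [? ? ?] := full_bounds oH ac.
  have ec : c = N.+1 by case: e => ?; lia.
  rewrite {}ec {e} in ac *.
  have aR : (a, k) \in half (restriction N H).
    by apply/in_half_restrictionP; right; exists N.+1; split=> //; lia.
  split=> //.
    (* A label larger than [k] would sit at a node [b] under the arc from [a] to [N.+1]. A half arc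
       of [H] there would not be exposed, and a cut arc would also have to end at [N.+1]. *)
    move=> l /PLabP[b bl]; rewrite leqNgt; apply/negP => kl.
    have ba : a < b.
      rewrite ltnNge; apply/negP => ba; have [eab|nab] := eqVneq a b.
        by subst b; have := half_label_uniq oR aR bl; lia.
      have ba' : b < a by lia.
      by have := label_half_half oR bl aR ba'; lia.
    case/in_half_restrictionP: bl => [[bl ?]|[d [bd ?]]].
      by have := half_exposed oH ac bl; lia.
    have [? ? ?] := full_bounds oH bd.
    have : (a, N.+1, k) = (b, d, l) by apply: (full_disjoint oH) => //; apply: Or44; lia.
    by case; lia.
  case: H oH oR aR ac => F G oH oR aR ac; congr HalfDiagram; apply/fsetP.
    move=> [[x y] z]; rewrite in_fset1U in_full_restriction /=; apply/idP/idP.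
      move=> xy; have [? ? ?] := full_bounds oH xy.
      have [yN|yN] := leqP y N; first by rewrite andbT xy orbT.
      apply/orP; left; apply/eqP; apply: (full_disjoint oH) => //; apply: Or44; lia.
    by case/orP=> [/eqP->|/andP[]].
  move=> [x y]; rewrite in_fsetD1; apply/idP/idP.
    move=> xy; have ? := half_bounds oH xy; apply/andP; split.
      apply/eqP=> -[? ?]; subst x y; apply: (okada_half_not_full oH xy).
      by exists a, N.+1, k; split; last left.
    apply/in_half_restrictionP; left; split=> //.
    have [eN|] := eqVneq x N.+1; last by lia.
    case: (okada_half_not_full oH xy).
    by exists a, N.+1, k; split; last right.
  case/andP=> /eqP nxy /in_half_restrictionP[[]|[b [xb xN]]] //.
  have [? ? ?] := full_bounds oH xb; have eb : b = N.+1 by lia.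
  subst b; have : (a, N.+1, k) = (x, N.+1, y) by apply: (full_disjoint oH) => //; apply: Or44.
  by case=> ? ?; case: nxy; congr pair.
left; exists h; have [? ?] := half_label oH nh; split=> //.
  move=> k /PLabP[a /in_half_restrictionP[[ak ?]|[b [ab ?]]]].
    exact: (label_half_half oH ak nh).
  have [? ? ?] := full_bounds oH ab; case: (okada_half_not_full oH nh).
  by exists a, b, k; split=> //; right; lia.
case: H oH oR nh => F G oH oR nh.
(* Since [N.+1] carries a half arc, no full arc ends there, so restricting to [N] cuts no arc. *)
have noN a b k : (a, b, k) \in F -> b <= N.
  move=> ab; have [? ? ?] := full_bounds oH ab.
  have [eN|] := eqVneq b N.+1; last by lia.
  by case: (okada_half_not_full oH nh); exists a, b, k; split; last right.
congr HalfDiagram; apply/fsetP.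
  by move=> [[x y] z]; rewrite in_full_restriction; symmetry; apply/andb_idr/noN.
move=> [x y]; rewrite in_fset1U; apply/idP/idP.
  move=> xy; have ? := half_bounds oH xy; apply/orP.
  have [eN|nN] := eqVneq x N.+1.
    by subst x; left; rewrite (half_label_uniq oH xy nh).
  by right; apply/in_half_restrictionP; left; split=> //; lia.
case/orP=> [/eqP[-> ->]//|/in_half_restrictionP[[]|[b [/noN]]] //]; lia.
Qed.

Lemma extends_restriction N H0 H : okada_half_diagram N H0 -> extends N H0 H ->
  restriction N H = H0.
Proof.
(* With [H0] written as its own restriction, both sides are compared through the same membership
   criteria. *)
move=> oH; rewrite -[RHS](restriction_id oH) => -[[h [_ _ _ ->]]|[c [k [ck _ ->]]]];
congr HalfDiagram; apply/fsetP.
- move=> [x y]; apply/idP/idP => /in_half_restrictionP e; apply/in_half_restrictionP; move: e.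
    case=> [[]|]; last by right.
    by rewrite in_fset1U => /orP[/eqP[]|] *; [lia|left].
  by case=> [[xy ?]|]; [left; rewrite in_fset1U xy orbT|right].
- move=> [[x y] z]; rewrite !inE /= !xpair_eqE andb_orl; case: (y =P N.+1) => [->|_]; rewrite ?ltnn ?andbF //.
- move=> [x y]; have ? := half_bounds oH ck.
  apply/idP/idP => /in_half_restrictionP e; apply/in_half_restrictionP; move: e.
    case=> [[]|[b []]]; first by rewrite in_fsetD1 => /andP[]; left.
    rewrite in_fset1U => /orP[/eqP[-> _ ->] _|*]; last by right; exists b.
    by left; split=> //; lia.
  case=> [[xy ?]|[b [xb ?]]]; last by right; exists b; rewrite in_fset1U xb orbT.
  have [[-> ->]|/eqP nxy] := (x, y) =P (c, k).
    (* The closed half arc comes back as the new full arc cut at [N]. *)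
    by right; exists N.+1; rewrite in_fset1U eqxx; split=> //; lia.
  by left; rewrite in_fsetD1 nxy.
Qed.

Lemma extends_okada N H0 H : okada_half_diagram N H0 -> extends N H0 H ->
  okada_half_diagram N.+1 H.
Proof.
move=> oH [[h [hN hp hmax ->]]|[c [k [ck kmax ->]]]].
  have fN a b l : (a, b, l) \in full H0 -> [/\ 1 <= a, a < b & b <= N] by move=> /(full_bounds oH).
  have hin a l : (a, l) \in half (add_half N.+1 h H0) ->
      (a = N.+1 /\ l = h) \/ ((a, l) \in half H0 /\ 1 <= a <= N).
    rewrite in_fset1U => /orP[/eqP[-> ->]|al]; first by left.
    by right; split=> //; exact: (half_bounds oH al).
  split.
  - by move=> a b l /fN[]; split=> //; lia.
  - exact: (full_disjoint oH).
  - by move=> a l /hin[[? ?]|[_ ?]]; lia.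
  - move=> a aN; have [->|na] := eqVneq a N.+1.
      split=> [_ [x [y [z [/fN[? ? ?]]]]]|_]; first by lia.
      by exists h; rewrite in_fset1U eqxx.
    have /(half_nodes oH)[h1 h2] : 1 <= a <= N by lia.
    split=> [[l /hin[[? ?]|[al _]]]|/h2[l al]]; first by lia.
      by apply: h1; exists l.
    by exists l; rewrite in_fset1U al orbT.
  - move=> a l m /hin[[? ?]|[al ?]] /hin[[? ?]|[am ?]]; try lia.
    exact: (half_label_uniq oH al am).
  - exact: (full_noncrossing oH).
  - move=> a b l c k ab /hin[[? ?]|[ck _]]; last exact: (half_exposed oH ab ck).
    by have [] := fN _ _ _ ab; lia.
  - exact: (full_label oH).
  - by move=> a l /hin[[-> ->]|[/(half_label oH)]].
  - exact: (label_nested oH).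
  - move=> a l x y z /hin[[? ?]|[al _]] xy; last exact: (label_half_full oH al xy).
    by have [] := fN _ _ _ xy; lia.
  - move=> a l b m /hin[[? ?]|[al ?]] /hin[[? ?]|[bm ?]] ab; try lia.
      by subst b m; apply: hmax; apply/PLabP; exists a.
    exact: (label_half_half oH al bm ab).
have cN := half_bounds oH ck.
have fin a b l : (a, b, l) \in full (close_half c k N.+1 H0) ->
    [/\ a = c, b = N.+1 & l = k] \/
    [/\ (a, b, l) \in full H0, 1 <= a, a < b & b <= N].
  rewrite in_fset1U => /orP[/eqP[-> -> ->]|ab]; first by left.
  by right; have [] := full_bounds oH ab.
(* Maximality of [k] makes [c] the rightmost half arc, so no remaining half arc lies under the new
   full arc. *)
have hin a l : (a, l) \in half (close_half c k N.+1 H0) ->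
    [/\ (a, l) \in half H0, 1 <= a, a < c & l < k].
  rewrite in_fsetD1 => /andP[/eqP ne al]; have ? := half_bounds oH al.
  have lk : l <= k by apply: kmax; apply/PLabP; exists a.
  have ac : a < c.
    have [//|ca|eac] := ltngtP a c; last by subst a; case: ne; rewrite (half_label_uniq oH al ck).
    by have := label_half_half oH ck al ca; lia.
  by split=> //; [lia|apply: (label_half_half oH al ck ac)].
have nodec a b l : (a, b, l) \in full H0 -> a <> c /\ b <> c.
  move=> ab; have nc := okada_half_not_full oH ck.
  by split=> e; apply: nc; exists a, b, l; split=> //; rewrite e; [left|right].
split.
- by move=> a b l /fin[[-> -> _]|[_ ? ? ?]]; split; lia.
- move=> a b l x y z /fin[[-> -> ->]|[ab ? ? ?]] /fin[[-> -> ->]|[xy ? ? ?]] //.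
  + by have [? ?] := nodec _ _ _ xy; case; lia.
  + by have [? ?] := nodec _ _ _ ab; case; lia.
  + exact: (full_disjoint oH ab xy).
- by move=> a l /hin[]; lia.
- move=> a aN; split.
    case=> l /hin[al ? ? ?] [x [y [z [/fin[[? ? ?]|[xy ? ? ?]]]]]]; first by lia.
    by move=> e; apply: (okada_half_not_full oH al); exists x, y, z.
  move=> nf.
  have ncN : a <> c /\ a <> N.+1.
    by split=> e; apply: nf; exists c, N.+1, k; rewrite in_fset1U eqxx; split=> //; [left|right].
  have /(half_nodes oH)[_ h2] : 1 <= a <= N by lia.
  case: h2 => [[x [y [z [xy e]]]]|l al].
    by apply: nf; exists x, y, z; rewrite in_fset1U xy orbT.
  exists l; rewrite in_fsetD1 al andbT; apply/eqP => -[]; lia.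
- by move=> a l m /hin[al _ _ _] /hin[am _ _ _]; apply: (half_label_uniq oH al am).
- move=> a b l x y z /fin[[? ? ?]|[ab ? ? ?]] /fin[[? ? ?]|[xy ? ? ?]]; try lia.
  (* An old arc crossing the new one would cover [c], where [H0] has a half arc. *)
  + by have := half_exposed oH ab ck; lia.
  + exact: (full_noncrossing oH ab xy).
- move=> a b l x y /fin[[? ? ?]|[ab ? ? ?]] /hin[xy ? ? ?]; first by lia.
  exact: (half_exposed oH ab xy).
- move=> a b l /fin[[-> _ ->]|[ab _ _ _]]; [exact: (half_label oH ck)|exact: (full_label oH ab)].
- by move=> a l /hin[/(half_label oH)].
- move=> a b l x y z /fin[[? ? ?]|[ab ? ? ?]] /fin[[-> ? ->]|[xy ? ? ?]]; try lia.
  (* Arcs nested in the new arc lay to the right of the half arc that it closes. *)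
  + by move=> ca _; apply: (label_half_full oH ck ab ca).
  + exact: (label_nested oH ab xy).
- move=> a l x y z /hin[al ? ? ?] /fin[[-> _ ->]|[xy ? ? ?]] //.
  exact: (label_half_full oH al xy).
- by move=> a l b m /hin[al _ _ _] /hin[bm _ _ _]; apply: (label_half_half oH al bm).
Qed.

(** * Fibonacci sets and their largest elements *)

Lemma sort_fset1U (B : {fset nat}) m : (forall x, x \in B -> x < m) ->
  sort leq (m |` B) = rcons (sort leq B) m.
Proof.
move=> Bm; apply: (sorted_eq leq_trans anti_leq); first exact: sort_sorted leq_total _.
  case E : (sort leq B) => [//|x s]; rewrite /= rcons_path.
  have := sort_sorted leq_total B; rewrite E /= => -> /=.
  by apply/ltnW/Bm; rewrite -(mem_sort leq) E mem_last.
rewrite perm_sort uniq_perm ?fset_uniq // ?rcons_uniq ?sort_uniq ?fset_uniq ?andbT.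
  by rewrite mem_sort; apply/negP => /Bm; rewrite ltnn.
by move=> x; rewrite mem_rcons in_cons mem_sort in_fset1U.
Qed.

Lemma cardfs1U_max (B : {fset nat}) m : (forall x, x \in B -> x < m) ->
  #|` m |` B| = #|` B|.+1.
Proof.
move=> Bm; rewrite cardfsU1; case: (boolP (m \in B)) => // /Bm; by rewrite ltnn.
Qed.

(** Turns deletion into insertion, so that the facts on adjoining a new maximum serve both
    directions of the covering relation. *)
Lemma remove_maxP A B :
  remove_max A B <-> exists m, (forall x, x \in B -> x < m) /\ A = m |` B.
Proof.
split=> [[m [mA Am ->]]|[m [Bm ->]]]; exists m.
  split; last by rewrite fsetD1K.
  by move=> x; rewrite in_fsetD1 => /andP[xm /Am]; lia.
split; first by rewrite in_fset1U eqxx.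
  by move=> x; rewrite in_fset1U => /orP[/eqP->//|/Bm]; lia.
by rewrite fsetU1K //; apply/negP => /Bm; rewrite ltnn.
Qed.

(** The new element comes last, at a position one more than the cardinality of [B]. That position
    has the parity of [n.+1], hence of [m]. *)
Lemma fibonacci_set_add n B m : fibonacci_set (RankedSet n B) ->
  (forall x, x \in B -> x < m) -> 1 <= m <= n.+1 -> m = n.+1 %[mod 2] ->
  fibonacci_set (RankedSet n.+1 (m |` B)).
Proof.
case=> /= Bn cB pB Bm mn pm.
have cB1 : #|` B|.+1 = n.+1 %[mod 2] by move: #|` B| cB => c; lia.
split=> /=.
- by move=> s; rewrite in_fset1U => /orP[/eqP->//|/Bn]; lia.
- by rewrite cardfs1U_max.
- move=> l; rewrite cardfs1U_max // sort_fset1U // nth_rcons size_sort ltnS leq_eqVlt.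
  case/orP=> [/eqP->|lB]; first by rewrite ltnn eqxx cB1.
  by rewrite lB pB.
Qed.

(** The position of the maximum is the cardinality, which is congruent to the rank. This forces the
    parity of a pushed label. *)
Lemma fibonacci_set_max n B m : fibonacci_set (RankedSet n (m |` B)) ->
  (forall x, x \in B -> x < m) -> 1 <= m <= n /\ m = n %[mod 2].
Proof.
case=> /= Bn cB pB Bm; split; first by apply: Bn; rewrite in_fset1U eqxx.
have := pB #|` B|; move: cB; rewrite cardfs1U_max // sort_fset1U // nth_rcons size_sort ltnn eqxx.
by move=> <-; exact.
Qed.

(** The cardinality drops by one while the rank grows by one, so they stay congruent; the remaining
    elements keep their positions. *)
Lemma fibonacci_set_remove n B m : fibonacci_set (RankedSet n (m |` B)) ->
  (forall x, x \in B -> x < m) -> fibonacci_set (RankedSet n.+1 B).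
Proof.
case=> /= Bn cB pB Bm; rewrite cardfs1U_max // in cB pB; split=> /=.
- by move=> s sB; have := Bn s; rewrite in_fset1U sB orbT => /(_ isT); lia.
- by move: #|` B| cB => c; lia.
- move=> l lB; have := pB l (ltnW lB).
  by rewrite sort_fset1U // nth_rcons size_sort lB.
Qed.

(** * Label sets of extensions and the covering relation *)

Lemma PLab_add_half a h H : PLab (add_half a h H) = h |` PLab H.
Proof.
apply/fsetP=> k; rewrite in_fset1U; apply/idP/idP.
  case/PLabP=> b; rewrite in_fset1U => /orP[/eqP[_ ->]|bk]; first by rewrite eqxx.
  by apply/orP; right; apply/PLabP; exists b.
case/orP=> [/eqP->|/PLabP[b bk]]; apply/PLabP; first by exists a; rewrite in_fset1U eqxx.
by exists b; rewrite in_fset1U bk orbT.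
Qed.

Lemma PLab_close_half N c k b H : okada_half_diagram N H -> (c, k) \in half H ->
  PLab (close_half c k b H) = PLab H `\ k.
Proof.
move=> oH ck; apply/fsetP=> l; rewrite in_fsetD1; apply/idP/idP.
  case/PLabP=> a; rewrite in_fsetD1 => /andP[/eqP ne al].
  apply/andP; split; last by apply/PLabP; exists a.
  by apply/eqP => e; subst l; apply: ne; rewrite (half_label_inj oH al ck).
case/andP=> /eqP lk /PLabP[a al]; apply/PLabP; exists a.
by rewrite in_fsetD1 al andbT; apply/eqP => -[_].
Qed.

Lemma PLab_remove_max N c k b H : okada_half_diagram N H -> (c, k) \in half H ->
  (forall l, l \in PLab H -> l <= k) ->
  remove_max (PLab H) (PLab (close_half c k b H)).
Proof.
move=> oH ck kmax; exists k; split=> //; last exact: PLab_close_half oH ck.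
by apply/PLabP; exists c.
Qed.

(** The Fibonacci property of [PLab H0] is a hypothesis because its general proof,
    [okada_fibonacci_set], is an induction that uses this lemma. *)
Lemma extends_covered_by N H0 H : okada_half_diagram N H0 ->
  fibonacci_set (RankedSet N (PLab H0)) -> extends N H0 H ->
  covered_by (RankedSet N (PLab H0)) (RankedSet N.+1 (PLab H)).
Proof.
move=> oH fS [[h [hN hp hmax ->]]|[c [k [ck kmax ->]]]].
  rewrite PLab_add_half; split=> //; first exact: fibonacci_set_add.
  by right; apply/remove_maxP; exists h.
have rm := PLab_remove_max N.+1 oH ck kmax; split=> //; last by left.
by case/remove_maxP: rm => m [Bm e]; rewrite e in fS; apply: fibonacci_set_remove fS Bm.
Qed.

(** Existence for a single step: a removed maximum tells which arc to close, an added one is the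
    label to push. *)
Lemma covered_by_extends N H0 S : okada_half_diagram N H0 ->
  covered_by (RankedSet N (PLab H0)) (RankedSet N.+1 S) ->
  exists2 H, extends N H0 H & PLab H = S.
Proof.
move=> oH [_ fT _ [|/remove_maxP] /=].
  case=> k [/PLabP[c ck] kmax eS]; exists (close_half c k N.+1 H0).
    by right; exists c, k.
  by rewrite (PLab_close_half N.+1 oH ck).
case=> m [Bm e]; rewrite e in fT *.
have [mN mp] := fibonacci_set_max fT Bm.
by exists (add_half N.+1 m H0); [left; exists m|rewrite PLab_add_half].
Qed.

(** Uniqueness for a single step. A pushed label exceeds all of [PLab H0], so it is recovered from
    the result and never arises from a pop. Two pops agree because both close the arc with the
    maximal label. *)
Lemma extends_PLab_inj N H0 H H' : okada_half_diagram N H0 ->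
  extends N H0 H -> extends N H0 H' -> PLab H = PLab H' -> H = H'.
Proof.
move=> oH [[h [_ _ hmax ->]]|[c [k [ck kmax ->]]]]
  [[h' [_ _ hmax' ->]]|[c' [k' [ck' kmax' ->]]]].
- rewrite !PLab_add_half => e; congr add_half.
  have : h \in h' |` PLab H0 by rewrite -e in_fset1U eqxx.
  rewrite in_fset1U => /orP[/eqP//|/hmax]; by rewrite ltnn.
- rewrite PLab_add_half (PLab_close_half N.+1 oH ck') => e.
  have : h \in PLab H0 `\ k' by rewrite -e in_fset1U eqxx.
  by rewrite in_fsetD1 => /andP[_ /hmax]; rewrite ltnn.
- rewrite PLab_add_half (PLab_close_half N.+1 oH ck) => e.
  have : h' \in PLab H0 `\ k by rewrite e in_fset1U eqxx.
  by rewrite in_fsetD1 => /andP[_ /hmax']; rewrite ltnn.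
- move=> _.
  have ek : k = k'.
    apply/anti_leq; rewrite kmax' ?kmax //; apply/PLabP; [by exists c'|by exists c].
  by subst k'; rewrite (half_label_inj oH ck ck').
Qed.

(** * From single steps to whole chains *)

Lemma okada0P H : okada_half_diagram 0 H <-> H = HalfDiagram fset0 fset0.
Proof.
split=> [oH|->]; last by split=> //= a; lia.
case: H oH => F G oH; congr HalfDiagram; apply/fsetP.
  by move=> [[a b] h]; rewrite in_fset0; apply/negP => /(full_bounds oH)[]; lia.
by move=> [a h]; rewrite in_fset0; apply/negP => /(half_bounds oH); lia.
Qed.

Lemma PLab0 : PLab (HalfDiagram fset0 fset0) = fset0.
Proof. by apply/fsetP=> k; rewrite in_fset0; apply/negP => /PLabP[a]. Qed.

(** Induction through the restriction to [N]: the covering relation of the last step contains the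
    Fibonacci property of its upper member. *)
Lemma okada_fibonacci_set N H : okada_half_diagram N H ->
  fibonacci_set (RankedSet N (PLab H)).
Proof.
elim: N H => [|N IH] H oH; first by rewrite (okada0P H).1 // PLab0; split.
have oR := okada_restriction (leqnSn N) oH.
by have [] := extends_covered_by oR (IH _ oR) (restriction_extends oH).
Qed.

Lemma restriction_extendsS N H i : okada_half_diagram N H -> i < N ->
  extends i (restriction i H) (restriction i.+1 H).
Proof.
move=> oH iN; rewrite -(restriction_restriction H (leqnSn i)).
exact: restriction_extends (okada_restriction iN oH).
Qed.

(** The bound keeps [inord] away from its default value. *)
Lemma ChainE N H i : i <= N -> Chain N H (inord i) = RankedSet i (PLab (restriction i H)).
Proof. by move=> iN; rewrite ffunE inordK. Qed.

Lemma Chain_saturated N H : okada_half_diagram N H -> saturated_chain (Chain N H).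
Proof.
move=> oH; split.
  by rewrite ffunE; have /okada0P -> := okada_restriction (leq0n N) oH; rewrite PLab0.
move=> i iN; rewrite !ChainE //; last exact: ltnW.
have oR := okada_restriction (ltnW iN) oH.
exact: extends_covered_by oR (okada_fibonacci_set oR) (restriction_extendsS oH iN).
Qed.

Lemma Chain_inj N H H' : okada_half_diagram N H -> okada_half_diagram N H' ->
  Chain N H = Chain N H' -> H = H'.
Proof.
move=> oH oH' e.
(* The two diagrams are rebuilt in parallel, one node at a time. *)
suff eR i : i <= N -> restriction i H = restriction i H'.
  by rewrite -(restriction_id oH) -(restriction_id oH') eR.
elim: i => [|i IH] iN.
  have /okada0P -> := okada_restriction iN oH.
  by have /okada0P -> := okada_restriction iN oH'.
have := restriction_extendsS oH' iN; rewrite -(IH (ltnW iN)) => e'.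
apply: (extends_PLab_inj (okada_restriction (ltnW iN) oH) (restriction_extendsS oH iN) e').
by have := ChainE H iN; rewrite e ChainE // => -[].
Qed.

Lemma Chain_surj N (C : {ffun 'I_N.+1 -> ranked_set}) : saturated_chain C ->
  exists2 H, okada_half_diagram N H & Chain N H = C.
Proof.
case=> C0 CS.
(* The invariant records all entries up to [i], so that its case [i = N] gives the whole chain. *)
suff /(_ N (leqnn N)) [H oH HC] : forall i, i <= N ->
    exists2 H, okada_half_diagram i H &
      forall j, j <= i -> C (inord j) = RankedSet j (PLab (restriction j H)).
  exists H => //; apply/ffunP => j; rewrite ffunE -HC ?inord_val //.
  by have := ltn_ord j; lia.
elim=> [_|i IH iN].
  have o0 : okada_half_diagram 0 (HalfDiagram fset0 fset0) by apply/okada0P.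
  exists (HalfDiagram fset0 fset0) => // j; rewrite leqn0 => /eqP->.
  rewrite (restriction_id o0) PLab0 -C0; congr (C _); apply/val_inj.
  by rewrite /= inordK.
have [H0 oH0 H0C] := IH (ltnW iN).
have := CS i iN; rewrite H0C // (restriction_id oH0).
case eS : (C (inord i.+1)) => [r S] cov.
have er : r = i.+1 by case: cov.
rewrite {r}er in eS cov.
have [H xH eH] := covered_by_extends oH0 cov.
have oH := extends_okada oH0 xH; exists H => // j.
rewrite leq_eqVlt => /orP[/eqP->|ji]; first by rewrite (restriction_id oH) eH.
(* Restricting the extension gives back [H0], so the earlier entries are unchanged. *)
by rewrite H0C // -(extends_restriction oH0 xH) restriction_restriction.
Qed.

Local Open Scope classical_set_scope.

Theorem proposition4p5 (N : nat) :
  set_bij [set H : half_diagram | okada_half_diagram N H]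
          [set C : {ffun 'I_N.+1 -> ranked_set} | saturated_chain C]
          (@Chain N).
Proof.
split=> [H /= oH|H H' /set_mem oH /set_mem oH'|C /= /Chain_surj[H]].
- exact: Chain_saturated.
- exact: Chain_inj.
- by exists H.
Qed.
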